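(* Let $(M^3,g)$ be a 3-dimensional pseudo-Riemannian manifold with Lorentzian metric $g$, and let $\alpha: I\subset\mathbb{R}\to M^3$ be a non-null unit speed Frenet curve with nowhere zero curvature $\kappa$ and torsion $\tau$. Assume that $\alpha$ is not a helix. Let $f:M^3\to\mathbb{R}$ be a smooth function which is eikonal along $\alpha$ and whose Hessian satisfies $H^f=0$. If $\alpha$ is a non-null $f$-eikonal slant helix in $M^3$, then $\alpha$ is also a non-null $f$-eikonal Darboux helix in $M^3$.
   Context: The metric $g$ is Lorentzian of signature $(-,+,+)$, $M^3$ is time-oriented, and $\nabla$ denotes its Levi-Civita connection. A unit speed non-null curve $\alpha(s)$ satisfies $g(\alpha',\alpha')=\varepsilon_1=\pm1$; it is a Frenet curve if $g(\alpha'',\alpha'')\neq0$, where $\alpha''=\nabla_{\alpha'}\alpha'$. Such a curve has an orthonormal Frenet frame $\{V_1=\alpha',V_2,V_3\}$ along it with $\varepsilon_i=g(V_i,V_i)=\pm1$, $\varepsilon_3=-\varepsilon_1\varepsilon_2$, satisfying $$\nabla_{V_1}V_1=\varepsilon_2\kappa V_2,\quad \nabla_{V_1}V_2=-\varepsilon_1\kappa V_1-\varepsilon_3\tau V_3,\quad \nabla_{V_1}V_3=\varepsilon_2\tau V_2,$$ where $\kappa\ge 0$ is the curvature and $\tau$ the torsion. ''Helix'' means general helix: the ratio $\tau/\kappa$ is constant along $\alpha$. For $f:M^3\to\mathbb{R}$ smooth, $\nabla f$ is the gradient, $g(\nabla f,X)=X(f)$, and the Hessian is $H^f(X,Y)=g(\nabla_X(\nabla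 f),Y)$. The function $f$ is eikonal along $\alpha$ if $\|\nabla f\|=\sqrt{|g(\nabla f,\nabla f)|}$ is constant along $\alpha$. Suppose $f$ is eikonal along $\alpha$. - $\alpha$ is a non-null $f$-eikonal slant helix if the function $g(\nabla f,V_2)$ is a non-zero constant along $\alpha$. - $\alpha$ is a non-null $f$-eikonal Darboux helix if $g(W_0,\nabla f)$ is constant along $\alpha$, where $$W_0=\frac{\tau}{\sqrt{|\varepsilon_3\kappa^2+\varepsilon_1\tau^2|}}V_1-\frac{\kappa}{\sqrt{|\varepsilon_3\kappa^2+\varepsilon_1\tau^2|}}V_3$$ is the unit Darboux vector of $\alpha$. *)

(* Defs.v *)
From HB Require Import structures.
From mathcomp Require Import all_boot all_order all_algebra.
From mathcomp Require Import all_classical all_reals all_analysis.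

Set Implicit Arguments.
Unset Strict Implicit.
Unset Printing Implicit Defensive.

Import Order.TTheory GRing.Theory Num.Theory.
Import numFieldNormedType.Exports.
Local Open Scope classical_set_scope.
Local Open Scope ring_scope.

(* [Ck k U f] is meant for [U] open and finite-dimensional [V], [W]; it is then
   the usual class C^k on [U]. *)
Fixpoint Ck (R : realType) (V W : normedModType R) (k : nat) (U : set V)
    (f : V -> W) : Prop :=
  match k with
  | 0%N => forall x, U x -> {for x, continuous f}
  | k'.+1 => (forall x, U x -> differentiable f x) /\
             (forall v, Ck k' U ('D_v f))
  end.

Definition smooth_on (R : realType) (V W : normedModType R) (U : set V)
    (f : V -> W) : Prop := forall k, Ck k U f.

(* A chart is a homeomorphism from an open subset [dom] of [M] onto an open
   subset of R^n; the values of [coord] off [dom] and of [inv] off the image are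
   irrelevant. *)
Record chart (R : realType) (M : topologicalType) (n : nat) := Chart {
  dom : set M;
  coord : M -> 'rV[R]_n;
  inv : 'rV[R]_n -> M;
  dom_open : open dom;
  img_open : open (coord @` dom);
  coordK : forall p, dom p -> inv (coord p) = p;
  coord_continuous : forall p, dom p -> {for p, continuous coord};
  inv_continuous : forall x, (coord @` dom) x -> {for x, continuous inv}
}.

(* Smooth n-manifolds. As part of the data, [chart_at p] is a preferred chart
   around [p]; it only serves to name the tangent spaces, see below. *)
Record manifold (R : realType) (n : nat) := Manifold {
  carrier :> topologicalType;
  carrier_hausdorff : hausdorff_space carrier;
  carrier_second_countable : @second_countable carrier;
  atlas : set (chart R carrier n);
  chart_at : carrier -> chart R carrier n;
  chart_at_atlas : forall p, atlas (chart_at p);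
  chart_at_dom : forall p, dom (chart_at p) p;
  transition_smooth : forall phi psi, atlas phi -> atlas psi ->
    smooth_on (coord phi @` (dom phi `&` dom psi)) (coord psi \o inv phi)
}.

(* The tangent space at [p] is R^n, a tangent vector being identified with its
   components in the chart [chart_at p]. *)
Definition vector_field (R : realType) (n : nat) (M : manifold R n) :=
  M -> 'rV[R]_n.

(* Components in [phi] of the tangent vector [v] at [p]. *)
Definition components (R : realType) (n : nat) (M : manifold R n)
    (phi : chart R M n) (p : M) (v : 'rV[R]_n) : 'rV[R]_n :=
  'D_v (coord phi \o inv (chart_at p)) (coord (chart_at p) p).

(* The coordinate vector field d/dx^i of [phi], meaningful on [dom phi]. *)
Definition coord_field (R : realType) (n : nat) (M : manifold R n)
    (phi : chart R M n) (i : 'I_n) : vector_field M :=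
  fun p => 'D_(delta_mx 0 i) (coord (chart_at p) \o inv phi) (coord phi p).

Definition smooth_fun_on (R : realType) (n : nat) (M : manifold R n)
    (U : set M) (h : M -> R) : Prop :=
  forall phi, atlas phi -> smooth_on (coord phi @` (U `&` dom phi)) (h \o inv phi).

Definition smooth_field_on (R : realType) (n : nat) (M : manifold R n)
    (U : set M) (X : vector_field M) : Prop :=
  forall phi, atlas phi -> smooth_on (coord phi @` (U `&` dom phi))
    ((fun p => components phi p (X p)) \o inv phi).

(* The derivative v(h) of a function in the direction of [v], tangent at [p]. *)
Definition dfun (R : realType) (n : nat) (M : manifold R n)
    (h : M -> R) (p : M) (v : 'rV[R]_n) : R :=
  'D_v (h \o inv (chart_at p)) (coord (chart_at p) p).

(* Lorentzian metrics, of signature (-,+,...,+): [gram p] is the Gram matrix on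
   the tangent space at [p], and the rows of [P] form an orthonormal basis. *)
Record lorentz_metric (R : realType) (n : nat) (M : manifold R n) :=
  LorentzMetric {
    gram : M -> 'M[R]_n;
    gram_signature : forall p, exists2 P : 'M[R]_n, P \in unitmx &
      P *m gram p *m P^T =
        diag_mx (\row_(i < n) (if val i == 0%N then -1 else 1));
    gram_smooth : forall phi, atlas phi -> forall i j,
      smooth_fun_on (dom phi) (fun p =>
        (coord_field phi i p *m gram p *m (coord_field phi j p)^T) 0 0)
  }.

Definition metric (R : realType) (n : nat) (M : manifold R n)
    (g : lorentz_metric M) (p : M) (u v : 'rV[R]_n) : R :=
  (u *m gram g p *m v^T) 0 0.

Definition time_orientation (R : realType) (n : nat) (M : manifold R n)
    (g : lorentz_metric M) (T : vector_field M) : Prop :=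
  smooth_field_on setT T /\ forall p, metric g p (T p) (T p) < 0.

(* Linear connections, acting on vector fields defined and smooth on open
   subsets: [nabla Y p v] is the derivative of [Y] in the direction of [v],
   tangent at [p]. *)
Record connection (R : realType) (n : nat) (M : manifold R n) := Connection {
  nabla : vector_field M -> forall p : M, 'rV[R]_n -> 'rV[R]_n;
  nabla_linear : forall U Y p, open U -> U p -> smooth_field_on U Y ->
    forall a u v, nabla Y p (a *: u + v) = a *: nabla Y p u + nabla Y p v;
  nabla_add : forall U Y Z p v, open U -> U p ->
    smooth_field_on U Y -> smooth_field_on U Z ->
    nabla (fun q => Y q + Z q) p v = nabla Y p v + nabla Z p v;
  nabla_leibniz : forall U h Y p v, open U -> U p ->
    smooth_fun_on U h -> smooth_field_on U Y ->
    nabla (fun q => h q *: Y q) p v = dfun h p v *: Y p + h p *: nabla Y p v;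
  nabla_smooth : forall U X Y, open U ->
    smooth_field_on U X -> smooth_field_on U Y ->
    smooth_field_on U (fun q => nabla Y q (X q))
}.

(* [X, Y] is expressed by its action X(Yh) - Y(Xh) on functions. *)
Definition torsion_free (R : realType) (n : nat) (M : manifold R n)
    (D : connection M) : Prop :=
  forall U X Y h p, open U -> U p ->
    smooth_field_on U X -> smooth_field_on U Y -> smooth_fun_on U h ->
    dfun h p (nabla D Y p (X p) - nabla D X p (Y p)) =
    dfun (fun q => dfun h q (Y q)) p (X p)
    - dfun (fun q => dfun h q (X q)) p (Y p).

Definition metric_compatible (R : realType) (n : nat) (M : manifold R n)
    (g : lorentz_metric M) (D : connection M) : Prop :=
  forall U X Y p v, open U -> U p ->
    smooth_field_on U X -> smooth_field_on U Y ->
    dfun (fun q => metric g q (X q) (Y q)) p v =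
    metric g p (nabla D X p v) (Y p) + metric g p (X p) (nabla D Y p v).

Definition levi_civita (R : realType) (n : nat) (M : manifold R n)
    (g : lorentz_metric M) (D : connection M) : Prop :=
  torsion_free D /\ metric_compatible g D.

Definition is_gradient (R : realType) (n : nat) (M : manifold R n)
    (g : lorentz_metric M) (f : M -> R) (G : vector_field M) : Prop :=
  smooth_field_on setT G /\ forall p v, metric g p (G p) v = dfun f p v.

(* The Hessian of the function with gradient [G]. *)
Definition hessian (R : realType) (n : nat) (M : manifold R n)
    (g : lorentz_metric M) (D : connection M) (G : vector_field M)
    (p : M) (u v : 'rV[R]_n) : R :=
  metric g p (nabla D G p u) v.

Definition smooth_curve (R : realType) (n : nat) (M : manifold R n)
    (I : set R) (alpha : R -> M) : Prop :=
  (forall s, I s -> {for s, continuous alpha}) /\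
  forall phi, atlas phi ->
    smooth_on (I `&` alpha @^-1` dom phi) (coord phi \o alpha).

Definition velocity (R : realType) (n : nat) (M : manifold R n)
    (alpha : R -> M) (s : R) : 'rV[R]_n :=
  'D_1 (coord (chart_at (alpha s)) \o alpha) s.

(* [V s] is a tangent vector at [alpha s]. *)
Definition smooth_field_along (R : realType) (n : nat) (M : manifold R n)
    (I : set R) (alpha : R -> M) (V : R -> 'rV[R]_n) : Prop :=
  forall phi, atlas phi -> smooth_on (I `&` alpha @^-1` dom phi)
    (fun t => components phi (alpha t) (V t)).

(* The covariant derivative along [alpha]. In a chart around [alpha s], the field
   is the sum of V^i d/dx^i, and its derivative is the sum of
   (V^i)' d/dx^i + V^i nabla_{alpha'} d/dx^i; this does not depend on the chart,
   which is taken to be [chart_at (alpha s)]. *)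
Definition covariant_derivative (R : realType) (n : nat) (M : manifold R n)
    (D : connection M) (alpha : R -> M) (V : R -> 'rV[R]_n) (s : R) : 'rV[R]_n :=
  let phi := chart_at (alpha s) in
  'D_1 (fun t => components phi (alpha t) (V t)) s
  + \sum_(i < n) V s 0 i *:
      nabla D (coord_field phi i) (alpha s) (velocity alpha s).

(* Unit speed non-null Frenet curves on the open interval [I], with their Frenet
   apparatus; eps3 = - eps1 * eps2. *)
Record frenet_curve (R : realType) (M : manifold R 3) (g : lorentz_metric M)
    (D : connection M) (I : set R) (alpha : R -> M) := FrenetCurve {
  V1 : R -> 'rV[R]_3;
  V2 : R -> 'rV[R]_3;
  V3 : R -> 'rV[R]_3;
  eps1 : R;
  eps2 : R;
  kappa : R -> R;
  tau : R -> R;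
  fc_open : open I;
  fc_interval : is_interval I;
  fc_smooth : smooth_curve I alpha;
  fc_V1 : forall s, I s -> V1 s = velocity alpha s;
  fc_V1_smooth : smooth_field_along I alpha V1;
  fc_V2_smooth : smooth_field_along I alpha V2;
  fc_V3_smooth : smooth_field_along I alpha V3;
  fc_eps1 : eps1 = 1 \/ eps1 = -1;
  fc_eps2 : eps2 = 1 \/ eps2 = -1;
  fc_V11 : forall s, I s -> metric g (alpha s) (V1 s) (V1 s) = eps1;
  fc_V22 : forall s, I s -> metric g (alpha s) (V2 s) (V2 s) = eps2;
  fc_V33 : forall s, I s -> metric g (alpha s) (V3 s) (V3 s) = - eps1 * eps2;
  fc_V12 : forall s, I s -> metric g (alpha s) (V1 s) (V2 s) = 0;
  fc_V13 : forall s, I s -> metric g (alpha s) (V1 s) (V3 s) = 0;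
  fc_V23 : forall s, I s -> metric g (alpha s) (V2 s) (V3 s) = 0;
  fc_acc : forall s, I s ->
    metric g (alpha s) (covariant_derivative D alpha (velocity alpha) s)
      (covariant_derivative D alpha (velocity alpha) s) != 0;
  fc_kappa_ge0 : forall s, I s -> 0 <= kappa s;
  fc_dV1 : forall s, I s ->
    covariant_derivative D alpha V1 s = (eps2 * kappa s) *: V2 s;
  fc_dV2 : forall s, I s -> covariant_derivative D alpha V2 s =
    (- eps1 * kappa s) *: V1 s - ((- eps1 * eps2) * tau s) *: V3 s;
  fc_dV3 : forall s, I s ->
    covariant_derivative D alpha V3 s = (eps2 * tau s) *: V2 s
}.

Definition eps3 (R : realType) (M : manifold R 3) (g : lorentz_metric M)
    (D : connection M) (I : set R) (alpha : R -> M)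
    (F : frenet_curve g D I alpha) : R := - eps1 F * eps2 F.

Definition constant_on (R : realType) (I : set R) (h : R -> R) : Prop :=
  exists c, forall s, I s -> h s = c.

Definition is_helix (R : realType) (M : manifold R 3) (g : lorentz_metric M)
    (D : connection M) (I : set R) (alpha : R -> M)
    (F : frenet_curve g D I alpha) : Prop :=
  constant_on I (fun s => tau F s / kappa F s).

(* Here and below, [G] is the gradient of the function under consideration. *)
Definition eikonal_along (R : realType) (n : nat) (M : manifold R n)
    (g : lorentz_metric M) (G : vector_field M) (I : set R) (alpha : R -> M)
    : Prop :=
  constant_on I
    (fun s => Num.sqrt `|metric g (alpha s) (G (alpha s)) (G (alpha s))|).

Definition eikonal_slant_helix (R : realType) (M : manifold R 3)
    (g : lorentz_metric M) (D : connection M) (I : set R) (alpha : R -> M)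
    (F : frenet_curve g D I alpha) (G : vector_field M) : Prop :=
  eikonal_along g G I alpha /\
  exists2 c : R, c != 0 &
    forall s, I s -> metric g (alpha s) (G (alpha s)) (V2 F s) = c.

Definition darboux_disc (R : realType) (M : manifold R 3)
    (g : lorentz_metric M) (D : connection M) (I : set R) (alpha : R -> M)
    (F : frenet_curve g D I alpha) (s : R) : R :=
  eps3 F * kappa F s ^+ 2 + eps1 F * tau F s ^+ 2.

Definition darboux_vector (R : realType) (M : manifold R 3)
    (g : lorentz_metric M) (D : connection M) (I : set R) (alpha : R -> M)
    (F : frenet_curve g D I alpha) (s : R) : 'rV[R]_3 :=
  (tau F s / Num.sqrt `|darboux_disc F s|) *: V1 F s
  - (kappa F s / Num.sqrt `|darboux_disc F s|) *: V3 F s.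

(* The non-vanishing of [darboux_disc] says that the unit Darboux vector is
   defined all along the curve. *)
Definition eikonal_darboux_helix (R : realType) (M : manifold R 3)
    (g : lorentz_metric M) (D : connection M) (I : set R) (alpha : R -> M)
    (F : frenet_curve g D I alpha) (G : vector_field M) : Prop :=
  [/\ eikonal_along g G I alpha,
      forall s, I s -> darboux_disc F s != 0 &
      constant_on I
        (fun s => metric g (alpha s) (darboux_vector F s) (G (alpha s)))].

(* Main.v *)
From HB Require Import structures.
Require Import Defs.
From mathcomp Require Import all_boot all_order all_algebra.
From mathcomp Require Import all_classical all_reals all_analysis.
From mathcomp Require Import ring.
Import Defs.
Import Order.TTheory GRing.Theory Num.Theory.
Import numFieldNormedType.Exports.
Local Open Scope classical_set_scope.
Local Open Scope ring_scope.

Set Implicit Arguments.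
Unset Strict Implicit.
Unset Printing Implicit Defensive.

(** Write [a_i = g (grad f, V_i)] for the Frenet components of the gradient.
    A zero Hessian makes [grad f] parallel, so [a_i] has derivative
    [g (grad f, D V_i / ds)] ([is_derive_gradient_along]), and the Frenet
    equations become a linear system for the [a_i]. When [a_2] is a non-zero
    constant [c], that system says
    [a_1' = e2 kappa c], [a_3' = e2 tau c], [kappa a_1 = e2 tau a_3],
    whence [K = e1 a_1 ^ 2 + e3 a_3 ^ 2] is constant ([first_integral]).

    If [d = e3 kappa ^ 2 + e1 tau ^ 2] is the quantity under the root in the
    Darboux vector, the last relation gives [K kappa ^ 2 = d a_3 ^ 2].
    - When [K] is not zero, neither [d] nor [a_3] vanishes, both keep their
      sign, and [g (W_0, grad f) = (tau a_1 - kappa a_3) / sqrt |d|] is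
      [sqrt |K|] up to a constant sign ([darboux_component_constant]).
    - When [K] is zero, [a_1 ^ 2 = e2 a_3 ^ 2], so [a_1 = q a_3] for one constant
      [q]: pointwise [q] is a sign if [e2 = 1], and strict monotonicity of
      [a_1] and [a_3], whose derivatives do not vanish, makes it the same
      everywhere. Differentiating, [kappa = q tau], so that the curve is a helix
      ([null_gradient_helix]), which is excluded.

    Differentiating [a_i] takes some calculus in charts: the covariant
    derivative along the curve is expressed with the coordinate fields of a
    chart, and compatibility of the connection with the metric can be applied to
    these fields only once they are known to be smooth ([coord_field_smooth]).
    This rests on the stability of C^k maps under composition ([Ck_comp]). *)

(** * Calculus of C^k maps *)

(** The first-order expansion of [f] at [x] is also one of [g], and a linear map
    with this property is the differential. *)
Lemma near_eq_differentiable (R : realType) (V W : normedModType R)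
    (f g : V -> W) (x : V) :
  (\near x, f x = g x) -> differentiable f x -> differentiable g x.
Proof.
move=> fg df.
have gE : g \o shift x = cst (g x) + 'd f x +o_ 0 id.
  apply/eqaddoP => e e0.
  have /eqaddoP/(_ e e0) := diff_locally df; have fgx := nbhs_singleton fg.
  rewrite (near_shift 0 x) /= in fg.
  apply: filterS2 fg => y; rewrite /= subr0 => fgy.
  by rewrite -![(_ - _ : _ -> _) _]/(_ - _) /= fgx fgy.
have dE : 'd g x = 'd f x :> (V -> W).
  by apply: diff_unique gE; exact: diff_continuous.
apply/diff_locallyP; rewrite dE; split => //; exact: diff_continuous.
Qed.

Section Ck_calculus.
Context {R : realType}.
Implicit Types V W Z : normedModType R.

(** [U] has to be open, since the derivatives at a point of [U] depend on a
    neighbourhood of it. *)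
Lemma Ck_eq V W k (U : set V) (f g : V -> W) : open U ->
  (forall x, U x -> f x = g x) -> Ck k U f -> Ck k U g.
Proof.
move=> oU; elim: k f g => [|k IH] f g fg /=.
  have nfg x : U x -> \near x, f x = g x.
    by move=> Ux; apply: filterS fg _; exact: open_nbhs_nbhs.
  move=> cf x Ux; have := cf x Ux; rewrite /prop_for /continuous_at (fg x Ux).
  by apply: cvg_trans; apply: near_eq_cvg; exact: nfg.
have nfg x : U x -> \near x, f x = g x.
  by move=> Ux; apply: filterS fg _; exact: open_nbhs_nbhs.
move=> [df Df]; split=> [x Ux|v].
  exact: near_eq_differentiable (nfg x Ux) (df x Ux).
apply: IH (Df v) => x Ux; exact/near_eq_derive/nfg.
Qed.

Lemma Ck_sub V W k (U U' : set V) (f : V -> W) :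
  U' `<=` U -> Ck k U f -> Ck k U' f.
Proof.
move=> sU; elim: k f => [|k IH] f /=; first by move=> cf x /sU/cf.
by move=> [df Df]; split=> [x /sU/df//|v]; exact: IH.
Qed.

Lemma CkW V W k (U : set V) (f : V -> W) : Ck k.+1 U f -> Ck k U f.
Proof.
elim: k f => [|k IH] f; first by move=> [df _] x /df/differentiable_continuous.
by move=> [df Df]; split=> // v; apply: IH.
Qed.

Lemma Ck_cst V W k (U : set V) (a : W) : Ck k U (fun=> a).
Proof.
elim: k a => [|k IH] a /=; first by move=> x _; exact: cst_continuous.
split=> [x _|v]; first exact: differentiable_cst.
have -> : 'D_v (fun=> a) = (fun=> 0) :> (V -> W).
  by apply/funext => x; exact: derive_cst.
exact: IH.
Qed.

Lemma Ck_add V W k (U : set V) (f g : V -> W) : open U ->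
  Ck k U f -> Ck k U g -> Ck k U (fun x => f x + g x).
Proof.
move=> oU; elim: k f g => [|k IH] f g /=.
  by move=> cf cg x Ux; apply: cvgD; [exact: cf|exact: cg].
move=> [df Df] [dg Dg]; split=> [x Ux|v].
  by apply: differentiableD; [exact: df|exact: dg].
apply: Ck_eq (IH _ _ (Df v) (Dg v)) => // x Ux.
by rewrite -deriveD//; apply: diff_derivable; [exact: df|exact: dg].
Qed.

Lemma Ck_sum V W k (U : set V) n (f : 'I_n -> V -> W) : open U ->
  (forall i, Ck k U (f i)) -> Ck k U (fun x => \sum_(i < n) f i x).
Proof.
move=> oU; elim: n f => [|n IH] f Cf.
  by apply: Ck_eq (Ck_cst k U 0) => // x _; rewrite big_ord0.
pose h x := \sum_(i < n) f (widen_ord (leqnSn n) i) x + f ord_max x.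
apply: (@Ck_eq _ _ _ _ h) => //; first by move=> x _; rewrite big_ord_recr.
by apply: Ck_add => //; exact: IH.
Qed.

(** The chain rule applied to the bilinear map [(b, w) |-> b *: w]. *)
Lemma derive_scale V W (a : V -> R) (f : V -> W) x :
  differentiable a x -> differentiable f x ->
  differentiable (fun y => a y *: f y) x /\
  forall v,
    'D_v (fun y => a y *: f y) x = a x *: 'D_v f x + 'D_v a x *: f x.
Proof.
move=> da df.
have sb : bilinear_for *:%R *:%R (@GRing.scale R W).
  by split=> u b y z /=; rewrite ?scalerDl ?scalerDr ?scalerA // mulrC.
pose sM := bilinear_isBilinear.Build R R W W *:%R *:%R (@GRing.scale R W) sb.
pose s : {bilinear R -> W -> W} := HB.pack (@GRing.scale R W) sM.
have sc : continuous (fun p : R * W => s p.1 p.2) by exact: scale_continuous.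
have dp : differentiable (fun y => (a y, f y)) x by exact: differentiable_pair.
have ds : differentiable (fun p : R * W => s p.1 p.2) (a x, f x).
  exact: differentiable_bilin.
have E : (fun y => a y *: f y) =
  (fun p : R * W => s p.1 p.2) \o (fun y => (a y, f y)) by [].
have dE : differentiable (fun y => a y *: f y) x.
  by rewrite E; exact: differentiable_comp.
split=> // v; rewrite deriveE// E diff_comp// diff_bilin// diff_pair//=.
by rewrite !deriveE.
Qed.

Lemma Ck_scale V W k (U : set V) (a : V -> R) (f : V -> W) : open U ->
  Ck k U a -> Ck k U f -> Ck k U (fun x => a x *: f x).
Proof.
move=> oU; elim: k a f => [|k IH] a f.
  by move=> ca cf x Ux; exact: cvgZ (ca x Ux) (cf x Ux).
move=> Ca Cf; have [da Da] := Ca; have [df Df] := Cf.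
split=> [x Ux|v]; first by have [] := derive_scale (da x Ux) (df x Ux).
apply: (@Ck_eq _ _ _ _ (fun x => a x *: 'D_v f x + 'D_v a x *: f x)) => //.
  by move=> x Ux; have [_ ->] := derive_scale (da x Ux) (df x Ux).
apply: Ck_add => //; first by apply: IH (Df v); exact: CkW Ca.
by apply: IH (Da v) _; exact: CkW Cf.
Qed.

Lemma Ck_coord V k n (U : set V) (f : V -> 'rV[R]_n) j : open U ->
  Ck k U f -> Ck k U (fun x => f x 0 j).
Proof.
move=> oU; elim: k f => [|k IH] f.
  move=> cf x Ux.
  apply: (@continuous_comp _ _ _ f (fun M : 'rV[R]_n => M 0 j)).
    exact: cf.
  exact/differentiable_continuous/differentiable_coord.
move=> [df Df]; split=> [x Ux|v].
  apply: (@differentiable_comp _ _ _ _ f (fun M : 'rV[R]_n => M 0 j)).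
    exact: df.
  exact: differentiable_coord.
apply: Ck_eq (IH _ (Df v)) => // x Ux.
by rewrite derive_mx ?mxE//; apply: diff_derivable; exact: df.
Qed.

Lemma derive_comp V W Z (f : V -> W) (g : W -> Z) x v :
  differentiable f x -> differentiable g (f x) ->
  'D_v (g \o f) x = 'D_('D_v f x) g (f x).
Proof.
move=> df dg; rewrite !deriveE//; first by rewrite diff_comp.
exact: differentiable_comp.
Qed.

Lemma derive_delta n W (g : 'rV[R]_n -> W) x w : differentiable g x ->
  'D_w g x = \sum_(j < n) w 0 j *: 'D_(delta_mx 0 j) g x.
Proof.
move=> dg; rewrite deriveE// {1}(row_sum_delta w) linear_sum.
by apply: eq_bigr => j _; rewrite linearZ deriveE.
Qed.

(** The class C^k is defined by iterating derivatives in constant directions,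
    whereas the chain rule differentiates [g] in the direction ['D_v f x], which
    depends on [x]. Expanding this direction in the canonical basis writes
    ['D_v (g \o f)] as a sum of products of C^k maps. *)
Lemma Ck_comp V n Z k (U : set V) (U' : set 'rV[R]_n)
    (f : V -> 'rV[R]_n) (g : 'rV[R]_n -> Z) : open U ->
  (forall x, U x -> U' (f x)) -> Ck k U f -> Ck k U' g -> Ck k U (g \o f).
Proof.
move=> oU fU; elim: k g => [|k IH] g.
  by move=> cf cg x Ux; apply: continuous_comp; [exact: cf|exact/cg/fU].
move=> Cf [dg Dg]; have [df Df] := Cf; split=> [x Ux|v].
  by apply: differentiable_comp; [exact: df|exact/dg/fU].
apply: (@Ck_eq _ _ _ _
  (fun x => \sum_(j < n) 'D_v f x 0 j *: ('D_(delta_mx 0 j) g \o f) x)) => //.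
  move=> x Ux; have dgf := dg _ (fU _ Ux).
  by rewrite (derive_comp v (df x Ux) dgf) [RHS]derive_delta.
apply: Ck_sum => // j; apply: Ck_scale => //; first exact: Ck_coord (Df v).
by apply: IH (Dg _); exact: CkW Cf.
Qed.

End Ck_calculus.

(** * Charts and tangent vectors *)

Section Charts.
Context {R : realType} {n : nat} {M : manifold R n}.
Implicit Types (phi psi chi : chart R M n) (p : M).

Lemma coord_image_open phi (U : set M) : open U ->
  open (coord phi @` (U `&` dom phi)).
Proof.
move=> oU; rewrite openE => _ [p [Up phip] <-]; rewrite /interior.
have imp : (coord phi @` dom phi) (coord phi p) by exists p.
have invU : \forall z \near coord phi p, U (inv phi z).
  apply: (inv_continuous imp); rewrite coordK//; exact: open_nbhs_nbhs.
have imgU := open_nbhs_nbhs (conj (@img_open _ _ _ phi) imp).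
apply: filterS2 invU imgU => _ /[swap] -[q phiq <-]; rewrite coordK// => Uq.
by exists q.
Qed.

Lemma near_image phi p : dom phi p -> nbhs (coord phi p) (coord phi @` dom phi).
Proof.
by move=> phip; apply: open_nbhs_nbhs; split; [exact: img_open|exists p].
Qed.

Lemma near_inv phi p (P : set M) : dom phi p -> nbhs p P ->
  \forall z \near coord phi p, P (inv phi z).
Proof.
move=> phip Pp; have imp : (coord phi @` dom phi) (coord phi p) by exists p.
by apply: (inv_continuous imp); rewrite coordK.
Qed.

Lemma near_dom phi p : dom phi p -> nbhs p (dom phi).
Proof. by move=> ?; apply: open_nbhs_nbhs; split => //; exact: dom_open. Qed.

Lemma transition_differentiable phi psi p : atlas phi -> atlas psi ->
  dom phi p -> dom psi p -> differentiable (coord psi \o inv phi) (coord phi p).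
Proof.
move=> aphi apsi phip psip.
by have [+ _] := transition_smooth aphi apsi 1; apply; exists p.
Qed.

(** The chain rule for the transition map [coord phi \o inv chi]: the components
    of a tangent vector transform in such a way that its action on functions
    does not depend on the chart. *)
Lemma derive_chart_change (W : normedModType R) (h : M -> W) phi chi p v :
  atlas phi -> atlas chi -> dom phi p -> dom chi p ->
  differentiable (h \o inv phi) (coord phi p) ->
  'D_v (h \o inv chi) (coord chi p) =
  'D_('D_v (coord phi \o inv chi) (coord chi p)) (h \o inv phi) (coord phi p).
Proof.
move=> aphi achi phip chip dh.
have dt := transition_differentiable achi aphi chip phip.
have E : (coord phi \o inv chi) (coord chi p) = coord phi p.
  by rewrite /= coordK.
transitivity ('D_v ((h \o inv phi) \o (coord phi \o inv chi)) (coord chi p)).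
  apply: near_eq_derive; have := near_inv chip (near_dom phip).
  by apply: filterS => z domz; rewrite /= coordK.
by rewrite derive_comp ?E.
Qed.

Lemma dfun_components (h : M -> R) phi p v : atlas phi -> dom phi p ->
  differentiable (h \o inv phi) (coord phi p) ->
  dfun h p v = 'D_(components phi p v) (h \o inv phi) (coord phi p).
Proof.
move=> aphi phip dh.
by apply: derive_chart_change => //; [exact: chart_at_atlas|exact: chart_at_dom].
Qed.

Lemma derive_chart_id phi p v : dom phi p ->
  'D_v (coord phi \o inv phi) (coord phi p) = v.
Proof.
move=> phip; rewrite -[RHS](derive_id (coord phi p) v).
apply: near_eq_derive; apply: filterS (near_image phip) => _ [q phiq <-].
by rewrite /= coordK.
Qed.

Lemma components_chart_at p v : components (chart_at p) p v = v.
Proof. by apply: derive_chart_id; exact: chart_at_dom. Qed.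

Lemma coord_field_chart_at p i : coord_field (chart_at p) i p = delta_mx 0 i.
Proof. by apply: derive_chart_id; exact: chart_at_dom. Qed.

(** A change of chart: [coord_field phi i p] is the image of the i-th basis vector
    under the differential of the transition from [phi] to the preferred chart. *)
Lemma derive_coord_field (W : normedModType R) (h : M -> W) phi p i :
  atlas phi -> dom phi p ->
  differentiable (h \o inv (chart_at p)) (coord (chart_at p) p) ->
  'D_(coord_field phi i p) (h \o inv (chart_at p)) (coord (chart_at p) p) =
  'D_(delta_mx 0 i) (h \o inv phi) (coord phi p).
Proof.
move=> aphi phip dh; apply/esym/derive_chart_change => //.
  exact: chart_at_atlas.
exact: chart_at_dom.
Qed.

(** In a chart [psi], the components of the i-th coordinate field of [phi] are
    the i-th partial derivatives of the transition map from [phi] to [psi],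
    evaluated at the inverse transition. *)
Lemma coord_field_smooth phi i : atlas phi ->
  smooth_field_on (dom phi) (coord_field phi i : vector_field M).
Proof.
move=> aphi psi apsi k.
have oU : open (coord psi @` (dom phi `&` dom psi)).
  by apply: coord_image_open; exact: dom_open.
pose t := 'D_(delta_mx 0 i) (coord psi \o inv phi) \o (coord phi \o inv psi).
apply: (@Ck_eq _ _ _ _ _ t) => //.
  move=> _ [p [phip psip] <-]; rewrite /t /= !coordK// /components.
  rewrite (@derive_coord_field _ (coord psi))//.
  by apply: transition_differentiable => //;
    [exact: chart_at_atlas|exact: chart_at_dom].
apply: (@Ck_comp _ _ _ _ _ _ (coord phi @` (dom psi `&` dom phi))) => //.
- by move=> _ [p [phip psip] <-]; exists p => //=; rewrite coordK.
- by rewrite setIC; exact: transition_smooth.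
- by rewrite setIC; have [_] := transition_smooth aphi apsi k.+1; apply.
Qed.

Lemma smooth_fun_differentiable (U : set M) (h : M -> R) phi p :
  smooth_fun_on U h -> atlas phi -> U p -> dom phi p ->
  differentiable (h \o inv phi) (coord phi p).
Proof.
by move=> sh aphi Up phip; have [+ _] := sh phi aphi 1; apply; exists p.
Qed.

End Charts.

(** * Differentiating a gradient along a curve *)

Section Gradient_along_a_curve.
Context {R : realType} {n : nat} {M : manifold R n} {g : lorentz_metric M}.

Lemma metric_is_linear p u : linear (metric g p u : 'rV[R]_n -> R^o).
Proof.
by move=> a v w; rewrite /metric linearP /= mulmxDr -scalemxAr !mxE.
Qed.

Lemma metricD p u v w : metric g p u (v + w) = metric g p u v + metric g p u w.
Proof. by have := metric_is_linear p u 1 v w; rewrite !scale1r. Qed.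

Lemma metricZ p u a v : metric g p u (a *: v) = a * metric g p u v.
Proof. by rewrite /metric linearZ /= -scalemxAr !mxE. Qed.

Lemma metric_sum p u m (v : 'I_m -> 'rV[R]_n) :
  metric g p u (\sum_(i < m) v i) = \sum_(i < m) metric g p u (v i).
Proof.
by rewrite /metric linear_sum mulmx_sumr summxE.
Qed.

(** The Gram matrix is congruent to a diagonal matrix. *)
Lemma gram_sym p : (gram g p)^T = gram g p.
Proof.
have [P Pu PE] := gram_signature g p.
have PtU : P^T \in unitmx by rewrite unitmx_tr.
have : P *m (gram g p)^T *m P^T = P *m gram g p *m P^T.
  by rewrite PE -[RHS]tr_diag_mx -PE !trmx_mul trmxK mulmxA.
move=> /(congr1 (mulmx^~ (invmx P^T))); rewrite !mulmxK//.
by move=> /(congr1 (mulmx (invmx P))); rewrite !mulKmx.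
Qed.

Lemma metricC p u v : metric g p u v = metric g p v u.
Proof.
by rewrite /metric -{1}(gram_sym p) -{1}[u]trmxK -!trmx_mul mxE mulmxA.
Qed.

(** The product rule for [g (grad f, V)] along a curve. In the preferred chart at
    [alpha s], the function is [\sum_j V^j (d f / d x^j)] along the curve. In
    its derivative, the terms [V^j (d f / d x^j)'] are computed by compatibility
    with the metric, applied to [grad f] and the j-th coordinate field: they
    give the Hessian term and the connection terms of [D V / ds]. *)
Lemma is_derive_gradient_along (D : connection M) (f : M -> R)
    (G : vector_field M) (I : set R) (alpha : R -> M) (V : R -> 'rV[R]_n) s :
  metric_compatible g D -> smooth_fun_on setT f -> is_gradient g f G ->
  open I -> smooth_curve I alpha -> smooth_field_along I alpha V -> I s ->
  is_derive s 1 (fun t => metric g (alpha t) (G (alpha t)) (V t))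
    (hessian g D G (alpha s) (velocity alpha s) (V s)
     + metric g (alpha s) (G (alpha s)) (covariant_derivative D alpha V s)).
Proof.
move=> gD sf [sG GE] oI [calpha salpha] sV Is.
set p := alpha s; pose phi := chart_at p.
have aphi : atlas phi by exact: chart_at_atlas.
have phip : dom phi p by exact: chart_at_dom.
pose x t := coord phi (alpha t); pose c t := components phi (alpha t) (V t).
pose F := f \o inv phi; pose dF j := 'D_(delta_mx 0 j) F.
have sF : smooth_on (coord phi @` (setT `&` dom phi)) F by exact: sf.
have xs : (coord phi @` (setT `&` dom phi)) (x s) by exists p.
have dx : differentiable x s by have [+ _] := salpha phi aphi 1; apply.
have dc : differentiable c s by have [+ _] := sV phi aphi 1; apply.
have ddF j : differentiable (dF j) (x s).
  by have [_ /(_ (delta_mx 0 j))[+ _]] := sF 2; apply.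
have dfE j q : dom phi q ->
    metric g q (G q) (coord_field phi j q) = dF j (coord phi q).
  move=> phiq; rewrite GE; apply: derive_coord_field => //.
  apply: smooth_fun_differentiable sf _ _ _ => //.
    exact: chart_at_atlas.
  exact: chart_at_dom.
have cs : c s = V s by exact: components_chart_at.
(* The right-hand side is the derivative that the Leibniz rule yields for the
   coordinate expression [\sum_j c^j * dF j] of the function. *)
have -> : hessian g D G p (velocity alpha s) (V s)
     + metric g p (G p) (covariant_derivative D alpha V s)
   = \sum_(j < n) (c s 0 j *: 'D_('D_1 x s) (dF j) (x s)
                   + 'D_1 c s 0 j *: dF j (x s)).
  rewrite /covariant_derivative -/p -/phi -/(c) metricD addrCA addrC big_split.
  congr (_ + _).
    rewrite /hessian cs [X in metric _ _ _ X](row_sum_delta (V s)) !metric_sum.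
    rewrite -big_split /=; apply: eq_bigr => j _; rewrite !metricZ -mulrDr.
    congr (_ * _).
    have := @gD (dom phi) G (coord_field phi j) p (velocity alpha s).
    rewrite coord_field_chart_at => <- //.
    + apply: near_eq_derive; apply: filterS (near_image phip) => _ [q phiq <-].
      by rewrite /= coordK// dfE.
    + exact: dom_open.
    + move=> psi apsi k; apply: Ck_sub (sG psi apsi k).
      by apply: image_subset => q [].
    + exact: coord_field_smooth.
  rewrite {1}(row_sum_delta ('D_1 c s)) metric_sum; apply: eq_bigr => j _.
  by rewrite metricZ -(coord_field_chart_at p j) dfE.
apply: (@near_eq_is_derive _ _ _ (\sum_(j < n) (fun t => c t 0 j *: dF j (x t)))).
  have nI : nbhs s I by exact: open_nbhs_nbhs.
  have nphi : \forall t \near s, dom phi (alpha t).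
    by apply: (calpha s Is); exact: near_dom.
  apply: filterS2 nI nphi => t It phit.
  rewrite fct_sumE /= GE (dfun_components _ aphi phit); last first.
    exact: (smooth_fun_differentiable sf).
  by rewrite derive_delta//; exact: (smooth_fun_differentiable sf).
apply: is_derive_sum => j.
have dcj : differentiable (fun t => c t 0 j) s.
  apply: (@differentiable_comp _ _ _ _ c (fun N : 'rV[R]_n => N 0 j)) => //.
  exact: differentiable_coord.
have ddx : differentiable (dF j \o x) s by exact: differentiable_comp.
have [d1 d2] := derive_scale dcj ddx.
apply: DeriveDef; first exact: diff_derivable.
rewrite d2 derive_comp//= [in RHS](@derive_mx _ _ _ _ c) ?mxE//.
exact: diff_derivable.
Qed.

End Gradient_along_a_curve.

(** * Functions with a non-vanishing derivative on an open interval *)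

Section Interval_calculus.
Context {R : realType} {I : set R}.
Context (oI : open I) (iI : is_interval I).
Implicit Types f df u v : R -> R.

Lemma derive_eq_on f h s a b : (forall x, I x -> f x = h x) -> I s ->
  is_derive s 1 f a -> is_derive s 1 h b -> a = b.
Proof.
move=> fh Is fa hb; case: fa hb => _ <- [_ <-].
apply: near_eq_derive; apply: filterS fh _; exact: open_nbhs_nbhs.
Qed.

Lemma is_derive_continuous f (s a : R) : is_derive s 1 f a -> {for s, continuous f}.
Proof. by move=> fa; apply/differentiable_continuous/derivable1_diffP. Qed.

Lemma interval_MVT f df a b : (forall x, I x -> is_derive x 1 f (df x)) ->
  I a -> I b -> exists2 c, I c & f b - f a = df c * (b - a).
Proof.
move=> fdf; wlog ab : a b / a <= b => [H Ia Ib|Ia Ib].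
  have [ab|/ltW ba] := leP a b; first exact: H.
  have [c Ic E] := H b a ba Ib Ia; exists c => //.
  by rewrite -opprB E -mulrN opprB.
have abI x : x \in `[a, b]%R -> I x by rewrite in_itv /=; exact: iI.
have [||c cab E] := @MVT_segment _ f df a b ab.
- by move=> x /subset_itv_oo_cc/abI/fdf.
- by apply: continuous_subspace_itv => x /abI/fdf/is_derive_continuous.
- by exists c => //; exact: abI.
Qed.

Lemma derive0_constant f : (forall x, I x -> is_derive x 1 f 0) ->
  constant_on I f.
Proof.
move=> f0; have [[s Is]|I0] := pselect (exists s, I s).
  exists (f s) => x Ix; apply/subr0_eq.
  by have [c _ ->] := interval_MVT f0 Is Ix; rewrite mul0r.
by exists 0 => x Ix; case: I0; exists x.
Qed.

Lemma derive_neq0_inj f df : (forall x, I x -> is_derive x 1 f (df x)) ->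
  (forall x, I x -> df x != 0) -> {in I &, injective f}.
Proof.
move=> fdf df0 x y /set_mem Ix /set_mem Iy fxy.
apply/eqP; rewrite eq_sym -subr_eq0.
have [c Ic /eqP] := interval_MVT fdf Ix Iy.
by rewrite fxy subrr eq_sym mulf_eq0 (negPf (df0 c Ic)).
Qed.

(** Otherwise the intermediate value theorem would give a zero. *)
Lemma continuous_neq0_sgr f a b : (forall x, I x -> {for x, continuous f}) ->
  (forall x, I x -> f x != 0) -> I a -> I b -> Num.sg (f a) = Num.sg (f b).
Proof.
move=> cf f0; wlog ab : a b / a <= b => [H Ia Ib|Ia Ib].
  have [ab|/ltW ba] := leP a b; first exact: H.
  by apply/esym; exact: H.
have abI x : x \in `[a, b]%R -> I x by rewrite in_itv /=; exact: iI.
have [] := ltgtP (f a) 0 => [fa|fa|/eqP]; last by rewrite (negPf (f0 a Ia)).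
- have [fb|fb|/eqP] := ltgtP (f b) 0; last by rewrite (negPf (f0 b Ib)).
  + by rewrite !ltr0_sg.
  + have [||c /abI/f0/eqP] // := @IVT _ f a b 0 ab.
      by apply: continuous_subspace_itv => x /abI/cf.
    by rewrite ge_min le_max (ltW fa) (ltW fb) orbT.
- have [fb|fb|/eqP] := ltgtP (f b) 0; last by rewrite (negPf (f0 b Ib)).
  + have [||c /abI/f0/eqP] // := @IVT _ f a b 0 ab.
      by apply: continuous_subspace_itv => x /abI/cf.
    by rewrite ge_min le_max (ltW fa) (ltW fb) orbT.
  + by rewrite !gtr0_sg.
Qed.

(** If [u x] is not zero, [u] does not vanish around [x], so [v] vanishes on a
    whole neighbourhood of [x], which injectivity excludes. *)
Lemma mul_eq0_inj u v : (forall x, I x -> {for x, continuous u}) ->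
  {in I &, injective v} -> (forall x, I x -> u x * v x = 0) ->
  forall x, I x -> u x = 0.
Proof.
move=> cu vI uv x Ix; apply: contrapT => /eqP ux0.
have v0 y : I y -> u y != 0 -> v y = 0.
  by move=> Iy uy0; have /eqP := uv y Iy; rewrite mulf_eq0 (negPf uy0) => /eqP.
have near_x : \forall y \near x, I y /\ u y != 0.
  near=> y; split; near: y; first exact: open_nbhs_nbhs.
  exact: cvgr_neq0 (cu x Ix) ux0.
have [y [yx [Iy uy0]]] : exists y, y != x /\ I y /\ u y != 0.
  move/nbhs_ballP : near_x => [e /= e0 xe].
  exists (x + e / 2); split; last first.
    apply: xe; rewrite /ball /= opprD addNKr normrN gtr0_norm ?divr_gt0//.
    by rewrite ltr_pdivrMr// mulr_natr mulr2n ltrDr.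
  by rewrite -subr_eq0 addrC addKr mulf_neq0 ?gt_eqF.
by move/eqP: yx; apply; apply: vI; rewrite ?inE// !v0.
Unshelve. all: by end_near. Qed.

(** Rolle's theorem makes [f] injective, and a continuous injective function on
    an interval is strictly monotone. The sign [e] encodes the direction, so that
    increasing and decreasing functions are handled together. *)
Lemma derive_neq0_homo f df : (forall x, I x -> is_derive x 1 f (df x)) ->
  (forall x, I x -> df x != 0) ->
  exists2 e : R, e = 1 \/ e = -1 &
    forall x y, I x -> I y -> x < y -> e * f x < e * f y.
Proof.
move=> fdf df0.
have IE : I = [set` Rhull I] by exact/is_intervalP.
have IP x : x \in Rhull I -> I x by rewrite {2}IE.
have PI x : I x -> x \in Rhull I by rewrite {1}IE.
have [||H|H] := @itv_continuous_inj_mono _ f (Rhull I).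
- by apply: continuous_subspace_itv => x /IP/fdf/is_derive_continuous.
- move=> x y /IP Ix /IP Iy; apply: (derive_neq0_inj fdf df0); exact: mem_set.
- exists 1; first by left.
  by move=> x y /PI Ix /PI Iy xy; rewrite !mul1r H.
- exists (-1); first by right.
  by move=> x y /PI Ix /PI Iy xy; rewrite !mulN1r ltrN2 H.
Qed.

(** Choose signs making [e1 * u] and [e2 * v] increasing. Their sum is then
    injective, and its product with their difference is zero; hence the
    difference vanishes identically. *)
Lemma sqr_eq_derive_neq0 u v du dv :
  (forall x, I x -> is_derive x 1 u (du x)) ->
  (forall x, I x -> is_derive x 1 v (dv x)) ->
  (forall x, I x -> du x != 0) -> (forall x, I x -> dv x != 0) ->
  (forall x, I x -> u x ^+ 2 = v x ^+ 2) ->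
  exists2 e : R, e = 1 \/ e = -1 & forall x, I x -> u x = e * v x.
Proof.
move=> hu hv du0 dv0 uv.
have [e1 e1E mu] := derive_neq0_homo hu du0.
have [e2 e2E mv] := derive_neq0_homo hv dv0.
have e1n : e1 * e1 = 1 by case: e1E => ->; rewrite ?mulrNN mulr1.
have e2n : e2 * e2 = 1 by case: e2E => ->; rewrite ?mulrNN mulr1.
exists (e1 * e2).
  by case: e1E => ->; case: e2E => ->; rewrite ?mulrNN ?mul1r ?mulr1; tauto.
have lt_sum x y : I x -> I y -> x < y ->
    e1 * u x + e2 * v x < e1 * u y + e2 * v y.
  by move=> Ix Iy xy; rewrite ltrD// ?mu ?mv.
have cuv x : I x -> {for x, continuous (fun y => e1 * u y - e2 * v y)}.
  move=> Ix; apply: cvgB; apply: cvgM; try exact: cvg_cst.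
    exact: is_derive_continuous (hu x Ix).
  exact: is_derive_continuous (hv x Ix).
have sI : {in I &, injective (fun x => e1 * u x + e2 * v x)}.
  move=> x y /set_mem Ix /set_mem Iy E.
  case: (ltgtP x y) => // xy.
    by have := lt_sum x y Ix Iy xy; rewrite E ltxx.
  by have := lt_sum y x Iy Ix xy; rewrite E ltxx.
have uv0 x : I x -> e1 * u x - e2 * v x = 0.
  apply: (mul_eq0_inj cuv sI) => {}x Ix.
  by rewrite -subr_sqr !exprMn uv// !expr2 e1n e2n subrr.
move=> x /uv0/subr0_eq E.
by rewrite -[LHS]mul1r -e1n -mulrA E mulrA.
Qed.

End Interval_calculus.

(** * The components of a parallel field with constant normal component *)

(** Here [a1], [a3] stand for the tangent and binormal components of the
    gradient, [c] for its normal component, [k] for the curvature and [t] for the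
    torsion; [- e1 * e2] is the third causal sign. *)
Section Frenet_system.
Context {R : realType} {I : set R} (oI : open I) (iI : is_interval I).
Context (e1 e2 c : R) (k t a1 a3 : R -> R).
Context (e1E : e1 = 1 \/ e1 = -1) (e2E : e2 = 1 \/ e2 = -1) (c0 : c != 0).
Context (k_gt0 : forall s, I s -> 0 < k s) (t0 : forall s, I s -> t s != 0).
Context (da1 : forall s, I s -> is_derive s 1 a1 (e2 * k s * c)).
Context (da3 : forall s, I s -> is_derive s 1 a3 (e2 * t s * c)).
Context (ka1E : forall s, I s -> k s * a1 s = e2 * t s * a3 s).

Lemma first_integral :
  exists K, forall s, I s -> e1 * a1 s ^+ 2 + (- e1 * e2) * a3 s ^+ 2 = K.
Proof.
apply: (derive0_constant iI) => s Is.
have h1 := da1 Is; have h3 := da3 Is.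
have -> : (fun s => e1 * a1 s ^+ 2 + (- e1 * e2) * a3 s ^+ 2) =
  e1 *: (a1 ^+ 2) + (- e1 * e2) *: (a3 ^+ 2) by [].
apply: is_derive_eq; rewrite /GRing.scale /= !expr1.
have r := ka1E Is.
have -> : e1 * (2 * a1 s * (e2 * k s * c))
    + - e1 * e2 * (2 * a3 s * (e2 * t s * c)) =
  2 * e1 * e2 * c * (k s * a1 s - e2 * t s * a3 s) by ring.
by rewrite r subrr mulr0.
Qed.

(** When [e2 = 1], [a1 = q * a3] with [q] a sign, by strict monotonicity; when
    [e2 = -1], [a1] and [a3] are both zero and any [q] would do. Differentiating
    [a1 = q * a3] gives [k = q * t]. *)
Lemma null_gradient_helix :
  (forall s, I s -> e1 * a1 s ^+ 2 + (- e1 * e2) * a3 s ^+ 2 = 0) ->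
  exists q, forall s, I s -> t s / k s = q.
Proof.
move=> K0.
have e1n0 : e1 != 0 by case: e1E => ->; rewrite ?oppr_eq0 oner_eq0.
have e2n0 : e2 != 0 by case: e2E => ->; rewrite ?oppr_eq0 oner_eq0.
have sq s : I s -> a1 s ^+ 2 = e2 * a3 s ^+ 2.
  move=> /K0 E; apply/subr0_eq/(mulfI e1n0); rewrite mulr0 -[RHS]E; ring.
have [q qE] : exists q, forall s, I s -> a1 s = q * a3 s.
  case: e2E => e2'.
    have [s Is|s Is|s Is|q _ qE] := sqr_eq_derive_neq0 oI iI da1 da3.
    - by rewrite !mulf_neq0// gt_eqF// k_gt0.
    - by rewrite !mulf_neq0// t0.
    - by rewrite sq// e2' mul1r.
    - by exists q.
  exists 1 => s Is; have /eqP := sq s Is.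
  rewrite e2' mulN1r eq_sym -subr_eq0 -opprD oppr_eq0 paddr_eq0 ?sqr_ge0//.
  by rewrite !sqrf_eq0 mul1r => /andP[/eqP-> /eqP->].
exists q^-1 => s Is.
have E : e2 * k s * c = q * (e2 * t s * c).
  apply: (derive_eq_on oI qE Is (da1 Is)).
  by have h3 := da3 Is; apply: is_derive_eq.
have kE : k s = q * t s.
  apply: (mulfI e2n0); apply: (mulIf c0); rewrite E; ring.
rewrite kE invfM mulrCA divff ?mulr1//; exact: t0.
Qed.

(** Everything follows from [K * k ^ 2 = d * a3 ^ 2]: it keeps [d] and [a3] away
    from zero, gives [d] the sign of [K], and yields
    [k * sqrt |K| = sqrt |d| * |a3|]. Eliminating [a1], the quantity in question
    is [e1 * e2 * d * a3 / (k * sqrt |d|)]. *)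
Lemma darboux_component_constant (K : R) : K != 0 ->
  (forall s, I s -> e1 * a1 s ^+ 2 + (- e1 * e2) * a3 s ^+ 2 = K) ->
  let d s := (- e1 * e2) * k s ^+ 2 + e1 * t s ^+ 2 in
  (forall s, I s -> d s != 0) /\
  exists b, forall s, I s ->
    t s / Num.sqrt `|d s| * a1 s - k s / Num.sqrt `|d s| * a3 s = b.
Proof.
move=> K0 KE d.
have kn0 s : I s -> k s != 0 by move=> /k_gt0; rewrite lt0r => /andP[].
have ss1 : e1 ^+ 2 = 1 by case: e1E => ->; rewrite ?sqrrN expr1n.
have ss2 : e2 ^+ 2 = 1 by case: e2E => ->; rewrite ?sqrrN expr1n.
have Kd s : I s -> K * k s ^+ 2 = d s * a3 s ^+ 2.
  move=> Is; rewrite -(KE s Is) mulrDl -[e1 * _ * _]mulrA -exprMn [a1 s * _]mulrC.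
  rewrite (ka1E Is) !exprMn ss2 /d; ring.
have da0 s : I s -> d s * a3 s ^+ 2 != 0.
  by move=> Is; rewrite -Kd// mulf_neq0// expf_neq0// kn0.
have d0 s : I s -> d s != 0 by move=> /da0; rewrite mulf_eq0 negb_or => /andP[].
have a30 s : I s -> a3 s != 0.
  by move=> /da0; rewrite mulf_eq0 negb_or sqrf_eq0 => /andP[].
split=> //.
have [[s0 I0]|nI] := pselect (exists s, I s); last first.
  by exists 0 => s Is; case: nI; exists s.
exists (e1 * e2 * Num.sg K * Num.sg (a3 s0) * Num.sqrt `|K|) => s Is.
have sgd : Num.sg (d s) = Num.sg K.
  have k2 : 0 < k s ^+ 2 by rewrite exprn_even_gt0 ?kn0.
  have a2 : 0 < a3 s ^+ 2 by rewrite exprn_even_gt0 ?a30.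
  have /(congr1 Num.sg) := Kd s Is.
  by rewrite sgrM (gtr0_sg k2) mulr1 sgrM (gtr0_sg a2) mulr1.
have sga : Num.sg (a3 s) = Num.sg (a3 s0).
  apply: (continuous_neq0_sgr iI _ a30) => // x Ix.
  exact: is_derive_continuous (da3 Ix).
have sd0 : Num.sqrt `|d s| != 0 by rewrite sqrtr_eq0 -ltNge normr_gt0 d0.
have absE : k s * Num.sqrt `|K| = Num.sqrt `|d s| * `|a3 s|.
  have -> : k s = Num.sqrt (k s ^+ 2) by rewrite sqrtr_sqr gtr0_norm ?k_gt0.
  rewrite -(sqrtr_sqr (a3 s)) mulrC -!sqrtrM ?normr_ge0//; congr (Num.sqrt _).
  rewrite -(ger0_norm (sqr_ge0 (k s))) -(ger0_norm (sqr_ge0 (a3 s))).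
  by rewrite -!normrM Kd.
apply: (mulfI (kn0 s Is)); apply: (mulfI sd0).
have -> : Num.sqrt `|d s| * (k s * (t s / Num.sqrt `|d s| * a1 s
    - k s / Num.sqrt `|d s| * a3 s)) =
  t s * (k s * a1 s) - k s ^+ 2 * a3 s by field.
rewrite (ka1E Is).
have -> : t s * (e2 * t s * a3 s) - k s ^+ 2 * a3 s = e1 * e2 * d s * a3 s.
  rewrite /d; have -> : e1 * e2 * (- e1 * e2 * k s ^+ 2 + e1 * t s ^+ 2) =
    - (e1 ^+ 2 * e2 ^+ 2 * k s ^+ 2) + e1 ^+ 2 * e2 * t s ^+ 2 by ring.
  by rewrite ss1 ss2; ring.
have -> : Num.sqrt `|d s|
    * (k s * (e1 * e2 * Num.sg K * Num.sg (a3 s0) * Num.sqrt `|K|)) =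
  Num.sqrt `|d s| * (e1 * e2 * Num.sg K * Num.sg (a3 s0))
    * (k s * Num.sqrt `|K|) by ring.
rewrite absE -sgd -sga.
have -> : Num.sqrt `|d s| * (e1 * e2 * Num.sg (d s) * Num.sg (a3 s))
    * (Num.sqrt `|d s| * `|a3 s|) =
  e1 * e2 * (Num.sg (d s) * (Num.sqrt `|d s| ^+ 2))
    * (Num.sg (a3 s) * `|a3 s|) by ring.
by rewrite sqr_sqrtr// -!numEsg.
Qed.

End Frenet_system.

(** * The theorem *)

Theorem theorem2p2 (R : realType) (M : manifold R 3) (g : lorentz_metric M)
    (T : vector_field M) (hT : time_orientation g T)
    (D : connection M) (hD : levi_civita g D)
    (I : set R) (alpha : R -> M) (F : frenet_curve g D I alpha)
    (hkappa : forall s, I s -> kappa F s != 0)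
    (htau : forall s, I s -> tau F s != 0)
    (hhelix : ~ is_helix F)
    (f : M -> R) (hf : smooth_fun_on setT f)
    (gradf : vector_field M) (hgrad : is_gradient g f gradf)
    (heik : eikonal_along g gradf I alpha)
    (hhess : forall (p : M) (u v : 'rV[R]_3), hessian g D gradf p u v = 0)
    (hslant : eikonal_slant_helix F gradf) :
  eikonal_darboux_helix F gradf.
Proof.
have [_ [c c0 a2E]] := hslant.
have oI := fc_open F; have iI := @fc_interval _ _ _ _ _ _ F.
pose a V s := metric g (alpha s) (gradf (alpha s)) (V s).
have da V s : smooth_field_along I alpha V -> I s ->
    is_derive s 1 (a V) (a (covariant_derivative D alpha V) s).
  move=> sV Is.
  have := is_derive_gradient_along hD.2 hf hgrad oI (fc_smooth F) sV Is.
  by rewrite hhess add0r.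
have k_gt0 s : I s -> 0 < kappa F s.
  by move=> Is; rewrite lt0r hkappa//; exact: fc_kappa_ge0.
have da1 s : I s -> is_derive s 1 (a (V1 F)) (eps2 F * kappa F s * c).
  move=> Is; apply: is_derive_eq (da _ _ (fc_V1_smooth F) Is) _.
  by rewrite /a (fc_dV1 _ Is) metricZ a2E.
have da3 s : I s -> is_derive s 1 (a (V3 F)) (eps2 F * tau F s * c).
  move=> Is; apply: is_derive_eq (da _ _ (fc_V3_smooth F) Is) _.
  by rewrite /a (fc_dV3 _ Is) metricZ a2E.
have e1n0 : eps1 F != 0.
  by case: (fc_eps1 F) => ->; rewrite ?oppr_eq0 oner_eq0.
(* The derivative of the constant [g (grad f, V2)] is zero. *)
have ka1E s : I s -> kappa F s * a (V1 F) s = eps2 F * tau F s * a (V3 F) s.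
  move=> Is; have h2 := da _ _ (fc_V2_smooth F) Is.
  have := derive_eq_on oI a2E Is h2 (is_derive_cst c s 1).
  rewrite /a (fc_dV2 _ Is) -scaleNr metricD !metricZ -!/(a _ _) => E.
  apply: (mulfI e1n0); apply: subr0_eq; rewrite -[RHS]oppr0 -E; ring.
have [K KE] := first_integral iI (eps1 F) da1 da3 ka1E.
have [K0|K0] := eqVneq K 0.
  case: hhelix.
  apply: (null_gradient_helix oI iI (fc_eps1 F) (fc_eps2 F) c0 k_gt0 htau da1 da3).
  by move=> s Is; rewrite KE.
have [d0 [b bE]] := darboux_component_constant iI (fc_eps1 F) (fc_eps2 F)
  k_gt0 da3 ka1E K0 KE.
split=> //; exists b => s Is; rewrite -(bE s Is) metricC /darboux_vector.
by rewrite -scaleNr metricD !metricZ mulNr.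
Qed.
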